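(* Let $k$ be a field of characteristic zero, $P_n=k[x_1,\ldots,x_n]$, and let $\mathscr{L}_n$ be the left-symmetric algebra of all derivations of $P_n$. Let $D\in\mathscr{L}_n$. Then the Jacobian matrix $J(D)$ of $D$ is nilpotent if and only if the divergence of every element of the Lie algebra $L_D$ is zero.
   Context: Write $\partial_i=\partial/\partial x_i$. For an $n$-tuple $F=(f_1,\ldots,f_n)$ of elements of $P_n$ put $D_F=f_1\partial_1+\cdots+f_n\partial_n$; every $k$-linear derivation $D$ of $P_n$ equals $D_F$ for a unique $F$. $\mathscr{L}_n$ is the vector space of all $k$-linear derivations of $P_n$ with the bilinear product determined by $(a\partial_i)\cdot(b\partial_j)=\big(a\,\partial_i(b)\big)\partial_j$ for $a,b\in P_n$; equivalently $D\cdot D_G=D_{D(G)}$, where $D(G)=(D(g_1),\ldots,D(g_n))$ for $G=(g_1,\ldots,g_n)$. The Witt algebra $W_n$ is the same vector space with the usual commutator bracket of derivations. The Jacobian matrix of $D=D_F$ is $J(D)=J(F)=(\partial_j(f_i))_{1\le i,j\le n}\in M_n(P_n)$, and the divergence is $\mathrm{div}(D)=\sum_{i=1}^n\partial_i(f_i)$. The right powers of $D$ are $D^{[1]}=D$ and $D^{[r+1]}=D^{[r]}\cdot D$ for $r\ge 1$. $L_D$ is the Lie subalgebra of $W_n$ generated by all right powers $D^{[i]}$, $i\ge 1$. *)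

(* Defs.v *)
From HB Require Import structures.
From mathcomp Require Import all_boot all_order all_algebra.
From mathcomp Require Import ring.
From mathcomp.multinomials Require Import mpoly.
From Stdlib Require Import FunctionalExtensionality ProofIrrelevance.

Set Implicit Arguments.
Unset Strict Implicit.
Unset Printing Implicit Defensive.

Import GRing.Theory.
Local Open Scope ring_scope.

Record derivation (k : fieldType) (n : nat) := Derivation {
  der_fun :> {mpoly k[n]} -> {mpoly k[n]};
  der_linear : linear der_fun;
  der_leibniz : forall p q, der_fun (p * q) = der_fun p * q + p * der_fun q
}.

HB.instance Definition _ (k : fieldType) (n : nat) (D : derivation k n) :=
  GRing.isLinear.Build k {mpoly k[n]} {mpoly k[n]} _ D (der_linear D).

Section Derivations.
Variables (k : fieldType) (n : nat).
Implicit Types D E : derivation k n.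
Implicit Types F G : {ffun 'I_n -> {mpoly k[n]}}.

Lemma der_ext D E : D =1 E -> D = E.
Proof.
case: D E => [d dl dm] [e el em] /= /functional_extensionality de; subst e.
by rewrite (proof_irrelevance _ dl el) (proof_irrelevance _ dm em).
Qed.

Definition derF_fun F (p : {mpoly k[n]}) := \sum_i F i * p^`M(i).

Fact derF_linear F : linear (derF_fun F).
Proof.
move=> a p q; rewrite /derF_fun scaler_sumr -big_split; apply: eq_bigr => i _.
by rewrite mderivD mderivZ mulrDr scalerAr.
Qed.

Fact derF_leibniz F p q :
  derF_fun F (p * q) = derF_fun F p * q + p * derF_fun F q.
Proof.
rewrite /derF_fun mulr_suml mulr_sumr -big_split; apply: eq_bigr => i _ /=.
by rewrite mderivM; ring.
Qed.

(* D_F = f_1 d/dx_1 + ... + f_n d/dx_n, and its inverse D |-> F. *)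
Definition derF F := Derivation (derF_linear F) (derF_leibniz F).

Definition der_coef D : {ffun 'I_n -> {mpoly k[n]}} := [ffun i => D 'X_i].

Lemma derFK : cancel derF der_coef.
Proof.
move=> F; apply/ffunP => i; rewrite ffunE /= /derF_fun (bigD1 i) //=.
rewrite big1 => [|j ji].
  rewrite mderivX mnm1E eqxx scale1r -[X in (X - _)%MM]add0m addmK.
  by rewrite mpolyX0 mulr1 addr0.
by rewrite mderivX mnm1E eq_sym (negbTE ji) scale0r mulr0.
Qed.

Lemma der1 D : D 1 = 0.
Proof.
have := der_leibniz D 1 1; rewrite !(mulr1, mul1r) => /esym/eqP.
by rewrite -subr_eq0 addrK => /eqP.
Qed.

Lemma der_coefK : cancel der_coef derF.
Proof.
move=> D; apply: der_ext; set E := derF _.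
have EX i : E 'X_i = D 'X_i.
  by have := congr1 (fun G : {ffun _} => G i) (derFK (der_coef D)); rewrite !ffunE.
have EM p q : E p = D p -> E q = D q -> E (p * q) = D (p * q).
  by rewrite !der_leibniz => -> ->.
have E1 : E 1 = D 1 by rewrite !der1.
move=> p; elim/mpolyind: p => [|c m p _ _ IH]; first by rewrite !raddf0.
rewrite !linearP; congr (_ *: _ + _) => //; rewrite mpolyXE_id.
elim/big_ind: _ => // i _; elim: (m i) => [|e IHe]; first by rewrite expr0.
by rewrite exprS; apply: EM.
Qed.

HB.instance Definition _ :=
  Choice.copy (derivation k n) (can_type der_coefK).

Fact der0_linear : linear (fun _ : {mpoly k[n]} => 0 : {mpoly k[n]}).
Proof. by move=> a p q; rewrite scaler0 addr0. Qed.
Fact der0_leibniz (p q : {mpoly k[n]}) : 0 = 0 * q + p * 0 :> {mpoly k[n]}.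
Proof. by rewrite mul0r mulr0 addr0. Qed.
Definition der_zero := Derivation der0_linear der0_leibniz.

Fact derN_linear D : linear (fun p => - D p).
Proof. by move=> a p q; rewrite linearP opprD scalerN. Qed.
Fact derN_leibniz D p q : - D (p * q) = - D p * q + p * - D q.
Proof. by rewrite der_leibniz opprD mulNr mulrN. Qed.
Definition der_opp D := Derivation (derN_linear D) (derN_leibniz D).

Fact derD_linear D E : linear (fun p => D p + E p).
Proof. by move=> a p q; rewrite !linearP scalerDr addrACA. Qed.
Fact derD_leibniz D E p q :
  D (p * q) + E (p * q) = (D p + E p) * q + p * (D q + E q).
Proof. by rewrite !der_leibniz mulrDl mulrDr addrACA. Qed.
Definition der_add D E := Derivation (derD_linear D E) (derD_leibniz D E).

Fact derZ_linear (a : k) D : linear (fun p => a *: D p).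
Proof. by move=> b p q; rewrite linearP scalerDr !scalerA mulrC. Qed.
Fact derZ_leibniz (a : k) D p q :
  a *: D (p * q) = (a *: D p) * q + p * (a *: D q).
Proof. by rewrite der_leibniz scalerDr scalerAl scalerAr. Qed.
Definition der_scale a D := Derivation (derZ_linear a D) (derZ_leibniz a D).

Fact der_addA : associative der_add.
Proof. by move=> D E G; apply: der_ext => p /=; rewrite addrA. Qed.
Fact der_addC : commutative der_add.
Proof. by move=> D E; apply: der_ext => p /=; rewrite addrC. Qed.
Fact der_add0 : left_id der_zero der_add.
Proof. by move=> D; apply: der_ext => p /=; rewrite add0r. Qed.
Fact der_addN : left_inverse der_zero der_opp der_add.
Proof. by move=> D; apply: der_ext => p /=; rewrite addNr. Qed.

HB.instance Definition _ := GRing.isZmodule.Build (derivation k n)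
  der_addA der_addC der_add0 der_addN.

Fact der_scaleA a b D : der_scale a (der_scale b D) = der_scale (a * b) D.
Proof. by apply: der_ext => p /=; rewrite scalerA. Qed.
Fact der_scale1 : left_id 1 der_scale.
Proof. by move=> D; apply: der_ext => p /=; rewrite scale1r. Qed.
Fact der_scaleDr : right_distributive der_scale +%R.
Proof. by move=> a D E; apply: der_ext => p /=; rewrite scalerDr. Qed.
Fact der_scaleDl D : {morph der_scale^~ D : a b / a + b}.
Proof. by move=> a b; apply: der_ext => p /=; rewrite scalerDl. Qed.

HB.instance Definition _ := GRing.Zmodule_isLmodule.Build k (derivation k n)
  der_scaleA der_scale1 der_scaleDr der_scaleDl.

(* The left-symmetric product: D . D_G = D_{D(G)}. *)
Definition lsmul D E : derivation k n := derF [ffun i => D (der_coef E i)].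

Lemma lsmul_derF D G : lsmul D (derF G) = derF [ffun i => D (G i)].
Proof. by rewrite /lsmul derFK. Qed.

(* D^[1] = D and D^[r+1] = D^[r] . D; only used for r >= 1. *)
Definition right_power D (r : nat) : derivation k n :=
  iter r.-1 (fun E => lsmul E D) D.

Fact lie_linear D E : linear (fun p => D (E p) - E (D p)).
Proof. by move=> a p q; rewrite !linearP scalerDr addrACA. Qed.
Fact lie_leibniz D E p q :
  D (E (p * q)) - E (D (p * q)) =
  (D (E p) - E (D p)) * q + p * (D (E q) - E (D q)).
Proof.
by rewrite !der_leibniz !raddfD /= !der_leibniz; ring.
Qed.
Definition lie_bracket D E := Derivation (lie_linear D E) (lie_leibniz D E).

Definition lie_subalgebra (S : derivation k n -> Prop) : Prop :=
  [/\ S 0,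
      forall (a : k) D E, S D -> S E -> S (a *: D + E)
    & forall D E, S D -> S E -> S (lie_bracket D E)].

(* Membership in L_D, the least Lie subalgebra of W_n containing every D^[r]. *)
Definition in_lie_right_powers D E : Prop :=
  forall S : derivation k n -> Prop,
    lie_subalgebra S ->
    (forall r : nat, (0 < r)%N -> S (right_power D r)) ->
    S E.

Definition jacobian D : 'M[{mpoly k[n]}]_n :=
  \matrix_(i, j) (der_coef D i)^`M(j).

Definition divergence D : {mpoly k[n]} := \sum_i (der_coef D i)^`M(i).

End Derivations.

(* Main.v *)
Require Import Defs.
From mathcomp Require Import all_boot all_order all_algebra.
From mathcomp.multinomials Require Import mpoly.

Import GRing.Theory.
Local Open Scope ring_scope.

Set Implicit Arguments.
Unset Strict Implicit.
Unset Printing Implicit Defensive.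

(** Proof idea.  Write J for the Jacobian matrix of D, J_r for that of the
    right power D^[r], and E(A) for the entrywise image of a matrix A under a
    derivation E; the divergence of E is the trace of its Jacobian matrix.

    The chain rule gives J(E . D) = J J(E) + E(J) (jacobian_lsmul), in
    particular J_(s+1) = J J_s + D^[s](J).  Since a trace is cyclic,
    E(tr J^(a+1)) = (a+1) tr(J^a E(J)) (der_mxtrace_exp).  Hence
      tr(J^a J_(s+1)) = tr(J^(a+1) J_s) + tr(J^a D^[s](J))
                      = tr(J^(a+1) J_s) + D^[s](tr J^(a+1)) / (a+1).
    As soon as tr J^b = 0 for all 0 < b < r, the correction terms vanish and
    div D^[r] = tr J_r = tr J^r (divergence_right_power).  By strong induction
    on r, all right powers are divergence-free if and only if all the tr J^r
    with r > 0 vanish, that is, in characteristic zero, if and only if J is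
    nilpotent (nilpotent_mxtrace_exp0).

    Passing from the right powers to the Lie algebra that they generate costs
    nothing: div [E, G] = E(div G) - G(div E), because the two products of
    Jacobian matrices have the same trace, so the divergence-free derivations
    form a Lie subalgebra (divergence_free_subalgebra). *)

(** * Nilpotency and traces of powers *)

Lemma mulmx_swap_expS (R : pzRingType) (m n : nat) (A : 'M[R]_(m, n))
    (B : 'M[R]_(n, m)) (j : nat) :
  (A *m B) ^+ j.+1 = A *m (B *m A) ^+ j *m B.
Proof.
elim: j => [|j IH]; first by rewrite expr1 expr0 mulmx1.
by rewrite exprS IH [in RHS]exprS /GRing.mul /= !mulmxA.
Qed.

Lemma mxtrace_swap_expS (R : comPzRingType) (m n : nat) (A : 'M[R]_(m, n))
    (B : 'M[R]_(n, m)) (j : nat) :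
  \tr ((A *m B) ^+ j.+1) = \tr ((B *m A) ^+ j.+1).
Proof. by rewrite mulmx_swap_expS -mulmxA mxtrace_mulC -mulmxA exprSr. Qed.

Lemma row_free_nilpotent (F : fieldType) (n : nat) (A : 'M[F]_n) (m : nat) :
  row_free A -> A ^+ m = 0 -> n = 0%N.
Proof.
move=> freeA; elim: m => [|m IH].
  by rewrite expr0 => /(congr1 (@mxrank F n n)); rewrite mxrank1 mxrank0.
by rewrite exprSr => /eqP; rewrite mulmx_free_eq0 // => /eqP.
Qed.

(** A singular A factors as C R through a space of smaller dimension, where
    R C inherits nilpotency and has the same trace; an invertible nilpotent
    matrix has size 0. *)
Lemma nilpotent_mxtrace0 (F : fieldType) (n : nat) (A : 'M[F]_n) (m : nat) :
  A ^+ m = 0 -> \tr A = 0.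
Proof.
elim/ltn_ind: n A m => n IH A m Am0.
have [freeA|] := boolP (row_free A).
  move: A {Am0 IH freeA} (row_free_nilpotent freeA Am0) => A n0.
  by subst n; rewrite (flatmx0 A) mxtrace0.
rewrite -row_leq_rank -ltnNge => rk_lt_n.
rewrite -[A]mulmx_base mxtrace_mulC (IH _ rk_lt_n _ m.+1) //.
by rewrite mulmx_swap_expS mulmx_base Am0 mulmx0 mul0mx.
Qed.

(** The trace of the Cayley-Hamilton identity reduces to n times the constant
    coefficient of the characteristic polynomial, that is to n det A up to
    sign. *)
Lemma row_free_mxtrace_exp (F : fieldType) (n : nat) (A : 'M[F]_n) :
  [pchar F] =i pred0 -> row_free A ->
  (forall j, (0 < j)%N -> \tr (A ^+ j) = 0) -> n = 0%N.
Proof.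
case: n A => // n A F0; rewrite row_free_unit unitmxE unitfE => detA trA0.
have := congr1 (@mxtrace F n.+1) (Cayley_Hamilton A).
rewrite mxtrace0 /horner_mx /horner_morph horner_coef raddf_sum /=.
rewrite size_map_poly size_char_poly big_ord_recl big1 => [|i _]; last first.
  by rewrite coef_map /= -mulmxE mul_scalar_mx mxtraceZ trA0 ?mulr0.
rewrite coef_map /= expr0 mulr1 mxtrace_scalar addr0 -mulr_natr => /eqP.
rewrite mulf_eq0 ((pcharf0P F).1 F0) orbF char_poly_det mulf_eq0.
by rewrite signr_eq0 (negbTE detA).
Qed.

(** The same reduction to smaller dimension as in nilpotent_mxtrace0, run
    backwards: nilpotency lifts from R C to C R. *)
Lemma mxtrace_exp0_nilpotent (F : fieldType) (n : nat) (A : 'M[F]_n) :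
  [pchar F] =i pred0 -> (forall j, (0 < j)%N -> \tr (A ^+ j) = 0) ->
  exists m, A ^+ m = 0.
Proof.
move=> F0; elim/ltn_ind: n A => n IH A trA0.
have [freeA|] := boolP (row_free A).
  (* An invertible A has size 0, where even A ^+ 0 = 1 is zero. *)
  exists 0%N; move: A {IH} freeA trA0 => A freeA trA0.
  have n0 := row_free_mxtrace_exp F0 freeA trA0.
  by subst n; apply: flatmx0.
rewrite -row_leq_rank -ltnNge => rk_lt_n.
have [|m Bm0] := IH _ rk_lt_n (row_base A *m col_base A).
  by case=> // j _; rewrite -mxtrace_swap_expS mulmx_base trA0.
by exists m.+1; rewrite -[A]mulmx_base mulmx_swap_expS Bm0 mulmx0 mul0mx.
Qed.

Lemma pchar0_inj (R S : idomainType) (f : {rmorphism R -> S}) :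
  injective f -> [pchar R] =i pred0 -> [pchar S] =i pred0.
Proof.
move=> f_inj /pcharf0P R0; apply/pcharf0P => n.
by rewrite -R0 -(rmorph_nat f) -(inj_eq f_inj) rmorph0.
Qed.

Lemma map_mxXn (R S : pzRingType) (f : {rmorphism R -> S}) (n : nat)
    (A : 'M[R]_n) (m : nat) :
  map_mx f (A ^+ m) = map_mx f A ^+ m.
Proof. exact: (rmorphXn (map_mx f : {rmorphism 'M_n -> 'M_n})). Qed.

(** Both conditions can be tested in the fraction field, where ranks and
    Gaussian elimination are available. *)
Lemma nilpotent_mxtrace_exp0 (R : idomainType) (n : nat) (A : 'M[R]_n) :
  [pchar R] =i pred0 ->
  (exists m, A ^+ m = 0) <-> (forall j, (0 < j)%N -> \tr (A ^+ j) = 0).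
Proof.
move=> R0; set f : {rmorphism R -> {fraction R}} := @tofrac R.
have f_inj : injective f.
  by move=> x y /eqP; rewrite /f /= tofrac_eq => /eqP.
split=> [[m Am0] j j_gt0 | trA0].
  apply: f_inj; rewrite rmorph0 -trace_map_mx map_mxXn.
  apply: (@nilpotent_mxtrace0 _ _ _ m).
  by rewrite exprAC -map_mxXn Am0 map_mx0 expr0n eqn0Ngt j_gt0.
have [j j_gt0|m fAm0] := mxtrace_exp0_nilpotent (A := map_mx f A)
  (pchar0_inj f_inj R0).
  by rewrite -map_mxXn trace_map_mx trA0 ?rmorph0.
exists m; apply/matrixP => i j; apply: f_inj.
by have /matrixP/(_ i j) := fAm0; rewrite -map_mxXn !mxE rmorph0.
Qed.

Section Derivations.
Variables (k : fieldType) (n : nat).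
Implicit Types D E : derivation k n.

(** * Derivations acting entrywise on matrices *)

Lemma der_mulmx E (m p q : nat) (A : 'M[{mpoly k[n]}]_(m, p))
    (B : 'M[{mpoly k[n]}]_(p, q)) :
  map_mx E (A *m B) = map_mx E A *m B + A *m map_mx E B.
Proof.
apply/matrixP => i j; rewrite !mxE raddf_sum -big_split /=.
by apply: eq_bigr => l _; rewrite !mxE der_leibniz.
Qed.

Lemma der_mxtrace E (m : nat) (A : 'M[{mpoly k[n]}]_m) :
  \tr (map_mx E A) = E (\tr A).
Proof. by rewrite /mxtrace raddf_sum; apply: eq_bigr => i _; rewrite mxE. Qed.

(** The matrices A and E(A) need not commute, but under the trace each of the
    a+1 terms of the Leibniz expansion of E(A^(a+1)) can be rotated to
    A^(a+b) E(A). *)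
Lemma mxtrace_mul_der_exp E (m : nat) (A : 'M[{mpoly k[n]}]_m) (a b : nat) :
  \tr (A ^+ b *m map_mx E (A ^+ a.+1))
  = \tr (A ^+ (a + b) *m map_mx E A) *+ a.+1.
Proof.
elim: a b => [|a IH] b; first by rewrite expr1.
rewrite exprS der_mulmx mulmxDr raddfD /= mulrSr addrC.
congr (_ + _); first by rewrite mulmxA -[A ^+ b *m A]exprSr IH addnS.
by rewrite mulmxA mxtrace_mulC mulmxA -[_ *m A ^+ b]exprD.
Qed.

Lemma der_mxtrace_exp E (m : nat) (A : 'M[{mpoly k[n]}]_m) (a : nat) :
  E (\tr (A ^+ a.+1)) = \tr (A ^+ a *m map_mx E A) *+ a.+1.
Proof.
have := mxtrace_mul_der_exp E A a 0.
by rewrite expr0 mul1mx der_mxtrace addn0.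
Qed.

(** * Jacobian matrices, divergence and Lie subalgebras *)

Lemma divergenceE E : divergence E = \tr (jacobian E).
Proof. by apply: eq_bigr => i _; rewrite mxE. Qed.

Lemma derE E p : E p = \sum_i E 'X_i * p^`M(i).
Proof.
rewrite -[E in LHS]der_coefK /= /derF_fun.
by apply: eq_bigr => i _; rewrite ffunE.
Qed.

(** Chain rule: with g_i = D(x_i) and d_j the derivative along x_j, the two
    factors of E(g_i) = sum_l E(x_l) d_l(g_i) contribute
    sum_l d_j(E(x_l)) d_l(g_i) and sum_l E(x_l) d_l(d_j(g_i)) = E(d_j(g_i)). *)
Lemma jacobian_lsmul E D :
  jacobian (lsmul E D) = jacobian D *m jacobian E + map_mx E (jacobian D).
Proof.
apply/matrixP => i j; rewrite !mxE /lsmul derFK ffunE derE raddf_sum /=.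
rewrite [E (mderiv _ _)]derE -big_split; apply: eq_bigr => l _ /=.
by rewrite !mxE mderivM !ffunE mulrC [X in _ = _ + _ * X]mderiv_comm.
Qed.

Lemma jacobian_linear (a : k) D E :
  jacobian (a *: D + E) = a%:MP *: jacobian D + jacobian E.
Proof.
apply/matrixP => i j; rewrite !mxE !ffunE /= mderivD mderivZ.
by rewrite mul_mpolyC.
Qed.

Lemma jacobian_lie_bracket D E :
  jacobian (lie_bracket D E) = jacobian (lsmul D E) - jacobian (lsmul E D).
Proof.
by apply/matrixP => i j; rewrite !mxE /lsmul !derFK !ffunE mderivB.
Qed.

Lemma divergence_lie_bracket D E :
  divergence (lie_bracket D E) = D (divergence E) - E (divergence D).
Proof.
rewrite !divergenceE jacobian_lie_bracket !jacobian_lsmul raddfB !raddfD /=.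
by rewrite !der_mxtrace mxtrace_mulC addrACA subrr add0r.
Qed.

Lemma divergence_free_subalgebra :
  lie_subalgebra (fun E : derivation k n => divergence E = 0).
Proof.
split=> [|a D E D0 E0|D E D0 E0].
- by rewrite /divergence big1 // => i _; rewrite ffunE /= raddf0.
- by rewrite divergenceE jacobian_linear raddfD /= mxtraceZ -!divergenceE D0 E0
    mulr0 addr0.
- by rewrite divergence_lie_bracket D0 E0 !raddf0 addr0.
Qed.

(** * Divergence of the right powers *)

Lemma right_powerS D r :
  (0 < r)%N -> right_power D r.+1 = lsmul (right_power D r) D.
Proof. by case: r. Qed.

Hypothesis k_char0 : [pchar k] =i pred0.

Lemma pchar0_mpoly : [pchar {mpoly k[n]}] =i pred0.
Proof.
apply: (pchar0_inj (f := @mpolyC n k)) => // a b /eqP.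
by rewrite mpolyC_eq => /eqP.
Qed.

Lemma mxtrace_exp_mul_der E (m : nat) (A : 'M[{mpoly k[n]}]_m) (a : nat) :
  \tr (A ^+ a.+1) = 0 -> \tr (A ^+ a *m map_mx E A) = 0.
Proof.
move=> trA0; apply/eqP; have := der_mxtrace_exp E A a.
rewrite trA0 raddf0 -mulr_natr => /esym/eqP.
by rewrite mulf_eq0 ((pcharf0P _).1 pchar0_mpoly) orbF.
Qed.

(** With J and J_s the Jacobian matrices of D and D^[s]: replacing J_(s+1) by
    J J_s + D^[s](J), whose last term has trace 0 against J^a, shows that
    tr(J^a J_s) is the same for all a + s = r with s > 0; s = 1 gives tr J^r
    and s = r gives tr J_r. *)
Lemma divergence_right_power D (r : nat) :
  (0 < r)%N ->
  (forall b, (0 < b < r)%N -> \tr (jacobian D ^+ b) = 0) ->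
  divergence (right_power D r) = \tr (jacobian D ^+ r).
Proof.
set J := jacobian D => r_gt0 trJ0.
suff: forall s a, (a + s.+1)%N = r ->
    \tr (J ^+ a *m jacobian (right_power D s.+1)) = \tr (J ^+ r).
  move/(_ r.-1 0%N); rewrite prednK // expr0 mul1mx divergenceE.
  exact.
elim=> [|s IH] a def_r; first by rewrite -def_r addn1 exprSr.
rewrite right_powerS // jacobian_lsmul mulmxDr raddfD /=.
rewrite mxtrace_exp_mul_der ?addr0; last first.
  by apply: trJ0; rewrite -def_r !addnS !ltnS leq_addr.
by rewrite mulmxA -[J ^+ a *m J]exprSr IH // addSnnS.
Qed.

Lemma right_powers_divergence_free D :
  (forall r, (0 < r)%N -> divergence (right_power D r) = 0) <->
  (forall r, (0 < r)%N -> \tr (jacobian D ^+ r) = 0).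
Proof.
split=> [div0 | tr0 r r_gt0]; last first.
  by rewrite divergence_right_power ?tr0 // => b /andP[b_gt0 _]; apply: tr0.
elim/ltn_ind=> r IH r_gt0.
by rewrite -divergence_right_power ?div0 // => b /andP[b_gt0 /IH]; apply.
Qed.

End Derivations.

Theorem theorem1 (k : fieldType) (k_char0 : [pchar k] =i pred0) (n : nat)
    (D : derivation k n) :
  (exists m : nat, jacobian D ^+ m = 0) <->
  (forall E : derivation k n, in_lie_right_powers D E -> divergence E = 0).
Proof.
rewrite (nilpotent_mxtrace_exp0 _ (@pchar0_mpoly _ n k_char0)).
rewrite -(right_powers_divergence_free k_char0); split=> [div0 E | div0 r r_gt0].
  by move/(_ _ (@divergence_free_subalgebra k n)); apply.
by apply: div0 => S _; apply.
Qed.
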